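(* Let $M \subseteq \mathbb{R}^k$ be non-empty and closed and let $n, d \ge 0$ be integers. Then $$r(M \times \mathbb{Z}^d) \ge (r(M)-1)\,2^d + 1$$ and $$(n+1)\,2^d + 1 \le r(\mathbb{R}^n \times \mathbb{Z}^d) \le (n+d)(n+1)\,2^d - n - d + 2.$$
   Context: For a non-empty set $M \subseteq \mathbb{R}^k$, the Radon number $r(M)$ is the minimal $r$ such that for every $A \subseteq M$ with $|A| \ge r$ there exist disjoint sets $B, C \subseteq A$ with $M \cap \mathrm{conv}\, B \cap \mathrm{conv}\, C \ne \emptyset$, where $\mathrm{conv}$ denotes the convex hull. If no such $r$ exists, $r(M) := \infty$ (with the usual arithmetic conventions for $\infty$). The sets $M \times \mathbb{Z}^d$ and $\mathbb{R}^n \times \mathbb{Z}^d$ are regarded as subsets of $\mathbb{R}^{k+d}$ and $\mathbb{R}^{n+d}$, respectively. *)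

(* Defs.v *)
From mathcomp Require Import all_boot all_order all_algebra.
From mathcomp Require Import all_classical all_reals all_analysis.

Set Implicit Arguments.
Unset Strict Implicit.
Unset Printing Implicit Defensive.

Import Order.TTheory GRing.Theory Num.Theory.
Import numFieldNormedType.Exports.

Local Open Scope classical_set_scope.
Local Open Scope card_scope.
Local Open Scope ring_scope.

Definition convex_hull (R : realType) (k : nat) (A : set 'rV[R]_k) :
    set 'rV[R]_k :=
  smallest (@convex_set R 'rV[R]_k) A.

(* [`I_r #<= A] says that A has at least r elements; A may be infinite. *)
Definition radon_property (R : realType) (k : nat) (M : set 'rV[R]_k)
    (r : nat) : Prop :=
  forall A : set 'rV[R]_k, A `<=` M -> `I_r #<= A ->
    exists B C : set 'rV[R]_k,
      [/\ B `<=` A, C `<=` A, B `&` C = set0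
        & M `&` convex_hull B `&` convex_hull C !=set0].

(* The Radon number lies in nat + {oo}; it is represented in \bar R so that the
   library's conventions for +oo apply. *)
Definition radon_number (R : realType) (k : nat) (M : set 'rV[R]_k) : \bar R :=
  match pselect (exists r, `[< radon_property M r >]) with
  | left ex_r => (ex_minn ex_r)%:R%:E
  | right _ => +oo%E
  end.

Definition int_points (R : realType) (d : nat) : set 'rV[R]_d :=
  [set x | forall j, x ord0 j \is a Num.int].

(* Cartesian product of M and N, as a subset of the (k + d)-dimensional space. *)
Definition prod_rV (R : realType) (k d : nat)
    (M : set 'rV[R]_k) (N : set 'rV[R]_d) : set 'rV[R]_(k + d) :=
  [set x | M (lsubmx x) /\ N (rsubmx x)].

(* Main.v *)
(* Lower bounds: if A has no Radon partition in M, then A x {0,1}^d has none in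
   M x Z^d.  A common point of two hulls has its integral part in the cube [0,1]^d,
   hence at a vertex, and only the points above that vertex contribute to it.  In R^n
   the set {0, e_1, .., e_n} has no Radon partition.

   Upper bound: the Helly number of Z^d is at most 2^d (Doignon), that of R^n at most
   n + 1, and the two multiply: project the intersections of n + 1 members of the
   family to Z^d, find a common point there by Doignon's theorem, and apply Helly's
   theorem in its fibre.  A subset of R^k with Helly number at most h has Radon number
   at most k (h - 1) + 2, by a refinement of the Eckhoff-Jamison inequality. *)

Require Import Defs.
From mathcomp Require Import all_boot all_order all_algebra.
From mathcomp Require Import all_classical all_reals all_analysis.
From mathcomp Require Import ring lra zify.
Import Order.TTheory GRing.Theory Num.Theory.
Import numFieldNormedType.Exports.
Local Open Scope classical_set_scope.
Local Open Scope ring_scope.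

Set Implicit Arguments.
Unset Strict Implicit.
Unset Printing Implicit Defensive.

(** * Convex combinations, hulls and affine dependence *)

Section Convexity.
Context {R : realType}.

Lemma convex_setP (V : lmodType R) (A : set V) :
  @convex_set R V A <->
  forall x y t, 0 <= t <= 1 -> A x -> A y -> A (t *: x + (1 - t) *: y).
Proof.
split=> [cA x y t t01 Ax Ay|cA x y l].
  have ti : Itv.spec (@Itv.num_sem R) (Itv.Real `[Posz 0, Posz 1]) t.
    by rewrite /Itv.spec/= /Itv.num_sem realE in_itv /=; case/andP: t01 => -> ->.
  have := cA x y (Itv.mk ti); rewrite !inE; exact.
rewrite !inE => Ax Ay; apply: cA => //; apply/andP; split; [exact: ge0|exact: le1].
Qed.

Lemma convex_set_sum (V : lmodType R) (A : set V) (I : finType)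
    (w : I -> R) (x : I -> V) :
  @convex_set R V A -> (forall i, 0 <= w i) -> \sum_i w i = 1 ->
  (forall i, 0 < w i -> A (x i)) -> A (\sum_i w i *: x i).
Proof.
move=> /convex_setP cA w0 w1 Ax.
(* Partial sums are normalised by their weight, so that each new term is one two-point combination.
   Positivity of the weight makes the division legitimate. *)
suff H (r : seq I) : 0 < \sum_(i <- r) w i ->
    A ((\sum_(i <- r) w i)^-1 *: \sum_(i <- r) w i *: x i).
  by have := H (index_enum I); rewrite w1 invr1 scale1r; apply; exact: ltr01.
elim: r => [|i r IH]; first by rewrite big_nil ltxx.
rewrite !big_cons => sgt0.
have r0 : 0 <= \sum_(j <- r) w j by apply: sumr_ge0.
have [wi0|wi0] := eqVneq (w i) 0.
  by rewrite wi0 scale0r !add0r; apply: IH; rewrite wi0 add0r in sgt0.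
have wi : 0 < w i by rewrite lt_def wi0 w0.
move: r0; rewrite le_eqVlt => /predU1P[r0|r0].
  have z j : j \in r -> w j = 0.
    move=> jr; apply/eqP; move/esym/eqP: r0; rewrite psumr_eq0 //.
    by move=> /allP /(_ j jr).
  rewrite -r0 addr0 [X in _ + X]big1_seq ?addr0 => [|j /andP[_ /z ->]]; last first.
    by rewrite scale0r.
  by rewrite scalerA mulVf // scale1r; apply: Ax.
have s0 : w i + \sum_(j <- r) w j != 0 by rewrite gt_eqF.
have -> : (w i + \sum_(j <- r) w j)^-1 *: (w i *: x i + \sum_(j <- r) w j *: x j)
  = (w i / (w i + \sum_(j <- r) w j)) *: x i
    + (1 - w i / (w i + \sum_(j <- r) w j)) *:
      ((\sum_(j <- r) w j)^-1 *: \sum_(j <- r) w j *: x j).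
  rewrite scalerDr !scalerA mulrC; congr (_ + _ *: _).
  by field; rewrite s0 gt_eqF.
apply: cA; [|exact: Ax|exact: IH].
by apply/andP; split; [exact/divr_ge0/ltW|rewrite ler_pdivrMr // mul1r lerDl ltW].
Qed.

Section Hull.
Context {k : nat}.
Implicit Types A B : set 'rV[R]_k.

Lemma convex_hull_convex A : @convex_set R 'rV[R]_k (convex_hull A).
Proof.
apply/convex_setP => x y t t01 Ax Ay B [cB AB].
by move/convex_setP: (cB); apply => //; [apply: Ax|apply: Ay].
Qed.

Lemma convex_hull_sub A B :
  @convex_set R 'rV[R]_k B -> A `<=` B -> convex_hull A `<=` B.
Proof. exact: smallest_sub. Qed.

Lemma subset_convex_hull A : A `<=` convex_hull A.
Proof. exact: sub_gen_smallest. Qed.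

Lemma convex_hull_mono A B : A `<=` B -> convex_hull A `<=` convex_hull B.
Proof.
move=> AB; apply: convex_hull_sub; first exact: convex_hull_convex.
by apply: subset_trans AB _; exact: subset_convex_hull.
Qed.

(** The segments from [a] to the hull of [A] fill a convex set containing [a] and [A]. A point of
    [A] supplies [z] when [t = 1]. *)
Lemma convex_hull_setU1 A a y : A !=set0 ->
  convex_hull (a |` A) y ->
  exists (t : R) z, [/\ 0 <= t <= 1, convex_hull A z & y = t *: a + (1 - t) *: z].
Proof.
move=> [b Ab]; apply: (convex_hull_sub (B := [set y | exists t z,
  [/\ 0 <= t <= 1, convex_hull A z & y = t *: a + (1 - t) *: z]])).
  apply/convex_setP => _ _ s /andP[s0 s1] [t [z [/andP[t0 t1] zA ->]]]
    [t' [z' [/andP[t'0 t'1] z'A ->]]].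
  (* [u] is the total weight of [a]. If [u = 1] the point is [a] itself; otherwise [z] and [z']
     share the weight [1 - u]. *)
  pose u : R := s * t + (1 - s) * t'.
  have u0 : 0 <= u by rewrite /u; nra.
  have u1 : u <= 1 by rewrite /u; nra.
  have [u1'|u1'] := eqVneq u 1.
    exists 1, b; split; [by rewrite ler01 lexx|exact: subset_convex_hull|].
    have e1 : s * (1 - t) = 0 by rewrite /u in u1'; nra.
    have e2 : (1 - s) * (1 - t') = 0 by rewrite /u in u1'; nra.
    rewrite !scalerDr !scalerA e1 e2 !scale0r !addr0 subrr scale0r addr0.
    by rewrite -scalerDl -/u u1'.
  have v0 : 0 < 1 - u by rewrite subr_gt0 lt_neqAle u1'.
  exists u, ((s * (1 - t) / (1 - u)) *: z + (1 - s * (1 - t) / (1 - u)) *: z').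
  split; first by rewrite u0 u1.
    have /convex_setP := @convex_hull_convex A; apply => //.
    apply/andP; split; first by apply: divr_ge0; [nra|exact: ltW].
    by rewrite ler_pdivrMr // mul1r /u; nra.
  rewrite !scalerDr !scalerA addrACA -scalerDl -/u.
  have cE : (1 - u) * (s * (1 - t) / (1 - u)) = s * (1 - t).
    by field; rewrite gt_eqF.
  congr (_ + (_ *: _ + _ *: _)); first by rewrite cE.
  rewrite [RHS]mulrBr mulr1 cE /u; ring.
move=> x [->|Ax].
  by exists 1, b; rewrite ler01 lexx subrr scale0r addr0 scale1r; split=> //;
    exact: subset_convex_hull.
exists 0, x; rewrite lexx ler01 subr0 scale0r add0r scale1r; split => //.
exact: subset_convex_hull.
Qed.

Lemma convex_hull_image_fin (I : finType) (x : I -> 'rV[R]_k) (F : {set I}) y :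
  convex_hull [set x i | i in [set` F]] y <->
  exists w : I -> R, [/\ forall i, 0 <= w i, forall i, i \notin F -> w i = 0,
    \sum_i w i = 1 & y = \sum_i w i *: x i].
Proof.
split; last first.
  move=> [w [w0 wF w1 ->]]; apply: convex_set_sum => //.
    exact: convex_hull_convex.
  move=> i wi; apply: subset_convex_hull; exists i => //=.
  by apply: contraLR wi => /wF ->; rewrite ltxx.
apply: (convex_hull_sub (B := [set y | exists w : I -> R,
  [/\ forall i, 0 <= w i, forall i, i \notin F -> w i = 0,
    \sum_i w i = 1 & y = \sum_i w i *: x i]])).
  apply/convex_setP => _ _ s /andP[s0 s1] [w [w0 wF w1 ->]] [v [v0 vF v1 ->]].
  exists (fun i => s * w i + (1 - s) * v i); split.
  - by move=> i; have := w0 i; have := v0 i; nra.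
  - by move=> i iF; rewrite wF // vF // !mulr0 addr0.
  - by rewrite big_split /= -!mulr_sumr w1 v1; ring.
  - rewrite !scaler_sumr -big_split /=; apply: eq_bigr => i _.
    by rewrite [RHS]scalerDl !scalerA.
move=> _ [i iF <-]; exists (fun j => (j == i)%:R); split.
- by move=> j; rewrite ler0n.
- by move=> j; case: eqP => // ->; rewrite iF.
- by rewrite (bigD1 i) //= eqxx big1 ?addr0 // => j /negbTE ->.
- rewrite (bigD1 i) //= eqxx scale1r big1 ?addr0 // => j /negbTE ->.
  by rewrite scale0r.
Qed.

(** The rows $(1, x_i)$ outnumber the dimension $k + 1$, hence are linearly dependent; the leading 1
    makes the coefficients sum to 0. *)
Lemma affine_dependence (I : finType) (F : {set I}) (x : I -> 'rV[R]_k) :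
  (k.+1 < #|F|)%N ->
  exists c : I -> R, [/\ forall i, i \notin F -> c i = 0, exists i, 0 < c i,
    \sum_i c i = 0 & \sum_i c i *: x i = 0].
Proof.
move=> Fk.
pose E : 'M[R]_(#|F|, 1 + k) := \matrix_i row_mx 1 (x (enum_val i)).
have : kermx E != 0.
  apply/eqP => /eqP; rewrite -mxrank_eq0 mxrank_ker subn_eq0 => h.
  by have := leq_trans h (rank_leq_col E); rewrite leqNgt Fk.
case/rowV0Pn => v /sub_kermxP vE v0.
pose c i := \sum_(j < #|F| | enum_val j == i) v 0 j.
have cS (V : lmodType R) (f : I -> V) :
    \sum_i c i *: f i = \sum_(j < #|F|) v 0 j *: f (enum_val j).
  under eq_bigr => i _ do rewrite scaler_suml.
  rewrite (exchange_big_dep xpredT) //=; apply: eq_bigr => j _.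
  by rewrite (big_pred1 (enum_val j)) // => i; rewrite eq_sym.
have cS1 : \sum_i c i = 0.
  rewrite (exchange_big_dep xpredT) //=.
  have /rowP /(_ 0) := vE; rewrite !mxE => e; rewrite -[RHS]e; apply: eq_bigr => j _.
  rewrite (big_pred1 (enum_val j)) => [|i]; last by rewrite eq_sym.
  by rewrite !mxE split1 unlift_none /= mxE mulr1.
have cSx : \sum_i c i *: x i = 0.
  rewrite cS; apply/rowP => a; have /rowP /(_ (rshift 1 a)) := vE.
  rewrite !mxE summxE => e; rewrite -[RHS]e; apply: eq_bigr => j _.
  by rewrite !mxE (unsplitK (inr a)).
have cE j : c (enum_val j) = v 0 j.
  rewrite /c (big_pred1 j) // => i /=; exact: (inj_eq enum_val_inj).
have cF i : i \notin F -> c i = 0.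
  move=> iF; rewrite /c big_pred0 // => j; apply: contraNF iF => /eqP <-.
  exact: enum_valP.
exists c; split => //.
(* Coefficients that are all nonpositive and sum to 0 vanish, against [v != 0]. *)
apply: contrapT => /forallNP c0.
have c0' i : c i = 0.
  apply/eqP; move/eqP: cS1; rewrite -oppr_eq0 -sumrN psumr_eq0.
    by move=> /allP /(_ i); rewrite mem_index_enum oppr_eq0; exact.
  by move=> {}i _; rewrite oppr_ge0 leNgt; apply/negP/c0.
by case/eqP: v0; apply/rowP => j; rewrite mxE -cE c0'.
Qed.
End Hull.
End Convexity.

(** * Caratheodory's theorem, Helly numbers and Helly's theorem *)

Section Helly.
Context {R : realType} {k : nat}.

(** While more than $k + 1$ points are left, subtracting a multiple of an affine dependence removes
    one of them. *)
Lemma caratheodory (I : finType) (x : I -> 'rV[R]_k) (F : {set I}) y :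
  convex_hull [set x i | i in [set` F]] y ->
  exists G : {set I}, [/\ G \subset F, (#|G| <= k.+1)%N &
    convex_hull [set x i | i in [set` G]] y].
Proof.
move: {2}#|F| (leqnn #|F|) => N; elim: N F => [|N IH] F FN Fy.
  by exists F; split=> //; apply: leq_trans FN _.
have [Fk|Fk] := leqP #|F| k.+1; first by exists F.
have [c [cF [i0 ci0] c0 cx]] := affine_dependence x Fk.
have [w [w0 wF w1 yE]] := (convex_hull_image_fin x F y).1 Fy.
(* The least ratio [w i / c i] is the largest multiple of [c] that keeps all weights nonnegative; it
   annihilates the weight at [i]. *)
have [i ci imin] : exists2 i, 0 < c i &
    forall j, 0 < c j -> w i / c i <= w j / c j.
  by case: (arg_minP (fun i => w i / c i) (P := fun i => 0 < c i) ci0) => i ci imin;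
    exists i.
have iF : i \in F by apply: contraLR ci => /cF ->; rewrite ltxx.
pose v j := w j - w i / c i * c j.
have vi : v i = 0 by rewrite /v divfK ?subrr // gt_eqF.
have v0 j : 0 <= v j.
  rewrite /v subr_ge0; have [cj|cj] := ltP 0 (c j).
    by rewrite -ler_pdivlMr // imin.
  apply: le_trans (w0 j); rewrite mulr_ge0_le0 //.
  by apply: divr_ge0 => //; exact: ltW.
have [||G [GF Gk Gy]] := IH (F :\ i); last first.
- by exists G; split=> //; apply: fintype.subset_trans GF (subD1set _ _).
- apply/convex_hull_image_fin; exists v; split => //.
  + move=> j; rewrite !inE negb_and negbK => /orP[/eqP->//|jF].
    by rewrite /v (wF _ jF) (cF _ jF) mulr0 subrr.
  + by rewrite sumrB w1 -mulr_sumr c0 mulr0 subr0.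
  + under eq_bigr => j _ do rewrite scalerBl -scalerA.
    by rewrite sumrB -scaler_sumr cx scaler0 subr0.
- by move: FN; rewrite (cardsD1 i) iF.
Qed.

(** An upper bound on the Helly number of [M] for the convexity formed by the traces on [M] of
    convex sets. *)
Definition helly_le (M : set 'rV[R]_k) (h : nat) :=
  forall (I : finType) (C : I -> set 'rV[R]_k),
    (forall i, @convex_set R 'rV[R]_k (C i)) ->
    (forall J : {set I}, (#|J| <= h)%N ->
      exists2 y, M y & forall i, i \in J -> C i y) ->
    exists2 y, M y & forall i, C i y.

(** Induction on the size of subfamilies: once all smaller ones have a common point, dropping the
    member [i] yields a point [x i] of all the others. *)
Lemma helly_le_critical (M : set 'rV[R]_k) (h : nat) :
  (forall (I : finType) (C : I -> set 'rV[R]_k) (x : I -> 'rV[R]_k) (J : {set I}),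
    (forall i, @convex_set R 'rV[R]_k (C i)) -> (h < #|J|)%N ->
    (forall i, i \in J -> M (x i)) ->
    (forall i j, i \in J -> j \in J -> i != j -> C j (x i)) ->
    exists2 y, M y & forall i, i \in J -> C i y) ->
  helly_le M h.
Proof.
move=> crit I C cC hC.
suff H : forall N (J : {set I}), #|J| = N -> exists2 y, M y & forall i, i \in J -> C i y.
  by have [y My Cy] := H _ [set: I]%SET erefl; exists y => // i; apply: Cy; rewrite inE.
elim=> [|N IH] J JN; first by apply: hC; rewrite JN.
have [Jh|Jh] := leqP #|J| h; first exact: hC.
have ex i : exists y, i \in J -> M y /\ forall j, j \in J :\ i -> C j y.
  have [iJ|_] := boolP (i \in J); last by exists 0.
  have [|y My Cy] := IH (J :\ i); last by exists y.
  by move: JN; rewrite (cardsD1 i) iJ => -[].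
have [x xP] := choice ex.
apply: (crit I C x J) => // [i /xP[]//|i j iJ jJ ij].
by have [_] := xP i iJ; apply; rewrite !inE eq_sym ij.
Qed.

(** Radon's argument: an affine dependence between the [x i], split by sign, gives one point with
    two representations. Each [j] is absent from one of them, whose points then all lie in [C j]. *)
Lemma helly_real_space : helly_le (@setT 'rV[R]_k) k.+1.
Proof.
apply: helly_le_critical => I C x J cC Jk _ Cx.
have [c [cJ [i0 ci0] c0 cx]] := affine_dependence x Jk.
pose P i := Num.max (c i) 0; pose N i := Num.max (- c i) 0.
have P0 i : 0 <= P i by rewrite /P le_max lexx orbT.
have N0 i : 0 <= N i by rewrite /N le_max lexx orbT.
have cPN i : c i = P i - N i.
  by rewrite /P /N; case: (leP (c i) 0); case: (leP (- c i) 0) => /=; lra.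
pose s := \sum_i P i.
have s0 : 0 < s.
  rewrite /s (bigD1 i0) //= ltr_pwDl ?sumr_ge0 //.
  by rewrite /P lt_max ci0.
have sN : s = \sum_i N i.
  by apply/eqP; rewrite -subr_eq0 -sumrB; under eq_bigr do rewrite -cPN; rewrite c0.
have xN : \sum_i P i *: x i = \sum_i N i *: x i.
  apply/eqP; rewrite -subr_eq0 -sumrB.
  by under eq_bigr do rewrite -scalerBl -cPN; rewrite cx.
have key (j : I) (w : I -> R) : j \in J -> (forall i, 0 <= w i) ->
    \sum_i w i = s -> (forall i, 0 < w i -> i \in J /\ i != j) ->
    C j (s^-1 *: \sum_i w i *: x i).
  move=> jJ w0 ws wi; rewrite scaler_sumr; under eq_bigr => i _ do rewrite scalerA.
  apply: convex_set_sum => // [i||i].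
  - by rewrite mulr_ge0 // invr_ge0 ltW.
  - by rewrite -mulr_sumr ws mulVf // gt_eqF.
  - by rewrite pmulr_rgt0 ?invr_gt0 // => /wi[iJ ij]; apply: Cx.
exists (s^-1 *: \sum_i P i *: x i) => // j jJ.
have [cj|cj] := ltP 0 (c j).
  rewrite xN; apply: key => // i; rewrite lt_max ltxx orbF oppr_gt0 => ci.
  split; first by apply: contraLR ci => /cJ ->; rewrite ltxx.
  by apply: contraTneq ci => ->; rewrite -leNgt ltW.
apply: key => // i; rewrite lt_max ltxx orbF => ci.
split; first by apply: contraLR ci => /cJ ->; rewrite ltxx.
by apply: contraTneq ci => ->; rewrite -leNgt.
Qed.
End Helly.

(** * A Helly theorem for finite closure operators on coloured points *)

Section ClosureHelly.
Variables (S T I : finType) (cl : {set S} -> {set S}) (col : S -> T) (J : {set I}).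
Hypothesis sub_cl : forall A : {set S}, A \subset cl A.
Hypothesis cl_mono : forall A B : {set S}, A \subset B -> cl A \subset cl B.
Hypothesis cl_idem : forall A, cl (cl A) = cl A.
Hypothesis anti_exchange : forall A x y, x \notin cl A ->
  x \in cl (y |: A) -> y \in cl (x |: A) -> x = y.
Hypothesis monochromatic_between : forall x y, x != y -> col x = col y ->
  exists p, [/\ p != x, p != y & p \in cl [set x; y]%SET].

(* Bell's argument for Doignon's theorem, without half-spaces: enlarge the C i as
   far as the absence of a common point permits, and choose x i in all the other
   C j with cl (x i |: C i) as small as possible.  If x i and x j have the same
   colour, the point p between them belongs to C i: otherwise
   cl (p |: C i) could replace C i, since a point q that it shares with the other C j
   would give a smaller hull than x i. *)
Lemma closure_helly (C : I -> {set S}) :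
  (forall i, i \in J -> cl (C i) = C i) -> (#|T| < #|J|)%N ->
  (forall i, i \in J -> exists x, forall j, j \in J -> j != i -> x \in C j) ->
  exists y, forall i, i \in J -> y \in C i.
Proof.
move=> clC TJ exC; apply: contrapT => noC.
(* Enlarging a [C i] decreases the total size of the complements, the measure of the induction. *)
have [N] := ubnP (\sum_(i in J) #|~: C i|)%N.
elim: N C clC exC noC => // N IH C clC exC noC CN.
have subC (A : {set S}) i : i \in J -> A \subset C i -> cl A \subset C i.
  by move=> iJ /cl_mono; rewrite clC.
pose X i : {set S} := [set x | [forall j in J, (j != i) ==> (x \in C j)]]%SET.
have XP i x : x \in X i -> forall j, j \in J -> j != i -> x \in C j.
  by rewrite inE => /forall_inP h j jJ ji; exact: (implyP (h j jJ)).
have XN i x : i \in J -> x \in X i -> x \notin C i.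
  move=> iJ xX; apply/negP => xC; apply: noC; exists x => j jJ.
  by have [->//|] := eqVneq j i; exact: (XP i).
have exx i : exists x, i \in J -> x \in X i /\
    forall y, y \in X i -> (#|cl (x |: C i)| <= #|cl (y |: C i)|)%N.
  have [iJ|iJ] := boolP (i \in J); last first.
    have /card_gt0P [j /exC [x _]] : (0 < #|J|)%N by apply: leq_trans TJ.
    by exists x.
  have [x0 x0P] := exC i iJ.
  have x0X : x0 \in X i.
    by rewrite inE; apply/forall_inP => j jJ; apply/implyP; exact: x0P.
  by case: (arg_minnP (fun y => #|cl (y |: C i)|) x0X) => x xX xmin; exists x.
have [x xP] := choice exx.
have between i p : i \in J -> p != x i -> p \in cl (x i |: C i) ->
    p \in C i.
  move=> iJ pi pcl; apply/contraT => pC.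
  have [xX xmin] := xP i iJ; have xC := XN _ _ iJ xX.
  pose D j := if j == i then cl (p |: C i) else C j.
  have CD j : C j \subset D j.
    by rewrite /D; case: eqP => // ->; apply: fintype.subset_trans (sub_cl _);
      exact: finset.subsetUr.
  case: (IH D).
  - by move=> j jJ; rewrite /D; case: eqP => // _; exact: clC.
  - move=> j /exC [y yP]; exists y => l lJ lj; exact: (fintype.subsetP (CD l)) (yP l lJ lj).
  - move=> [q qD].
    have qX : q \in X i.
      rewrite inE; apply/forall_inP => j jJ; apply/implyP => ji.
      by have := qD j jJ; rewrite /D (negbTE ji).
    have qp : q \in cl (p |: C i) by have := qD i iJ; rewrite /D eqxx.
    have sub1 a b : a \in cl (b |: C i) -> cl (a |: C i) \subset cl (b |: C i).
      move=> ab; rewrite -[cl (b |: _)]cl_idem; apply: cl_mono.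
      rewrite finset.subUset finset.sub1set ab /=; apply: fintype.subset_trans (sub_cl _).
      exact: finset.subsetUr.
    (* If the hull with [q] contained [x i], so would the hull with [p]; as [p] lies in the hull
       with [x i], anti-exchange would force [p = x i]. *)
    have : cl (q |: C i) \proper cl (x i |: C i).
      apply/properP; split; first exact: fintype.subset_trans (sub1 _ _ qp) (sub1 _ _ pcl).
      exists (x i); first by apply: (fintype.subsetP (sub_cl _)); rewrite !inE eqxx.
      apply: contra pi => /(fintype.subsetP (sub1 _ _ qp)) xp.
      by apply/eqP; apply: (anti_exchange (A := C i)) => //; rewrite clC.
    by move/proper_card; rewrite ltnNge xmin.
  - apply: leq_trans (_ : (\sum_(j in J) #|~: C j| <= N)%N); last by [].
    rewrite [X in (X < _)%N](bigD1 i) //= [X in (_ < X)%N](bigD1 i) //=.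
    rewrite -addSn leq_add //.
      apply: proper_card; rewrite properC; apply/properP; split; first exact: CD.
      exists p => //; rewrite /D eqxx; apply: (fintype.subsetP (sub_cl _)).
      by rewrite !inE eqxx.
    by apply: leq_sum => j _; apply: subset_leq_card; rewrite finset.setCS; exact: CD.
(* Pigeonhole: there are more members than colours. *)
have /dinjectivePn [i iJ [j]] : ~~ dinjectiveb (fun i => col (x i)) (mem J).
  apply/dinjectiveP => inj; move: TJ.
  by rewrite -(card_in_imset inj) ltnNge max_card.
rewrite !inE => /andP[ji jJ] cij.
have [xiX _] := xP i iJ; have [xjX _] := xP j jJ.
have xij : x i != x j.
  by apply: contra (XN _ _ iJ xiX) => /eqP ->; apply: (XP _ _ xjX) => //; rewrite eq_sym.
have [p [pi pj pcl]] := monochromatic_between xij cij.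
apply: noC; exists p => l lJ.
have incl (A : {set S}) : x i \in A -> x j \in A -> [set x i; x j]%SET \subset A.
  by move=> iA jA; rewrite finset.subUset !finset.sub1set iA.
(* For [l = i], the point [x j] belongs to [C i], so [p] lies in the hull of [x i |: C i]; the case
   [l = j] is symmetric. Every other [C l] contains both points. *)
have [li|li] := eqVneq l i.
  rewrite li; apply: between => //; apply: (fintype.subsetP (cl_mono (incl _ _ _))) pcl.
    by rewrite !inE eqxx.
  by rewrite inE (XP _ _ xjX) ?orbT // eq_sym.
have [lj|lj] := eqVneq l j.
  rewrite lj; apply: between => //; apply: (fintype.subsetP (cl_mono (incl _ _ _))) pcl.
    by rewrite inE (XP _ _ xiX) ?orbT.
  by rewrite !inE eqxx.
apply: (fintype.subsetP (subC _ _ lJ (incl _ _ _))) pcl.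
  exact: (XP _ _ xiX).
exact: (XP _ _ xjX).
Qed.
End ClosureHelly.

(** * Doignon's theorem for the integer lattice *)

Section Doignon.
Context {R : realType}.

(** Eliminating [y] from $x = ty + (1-t)z$ and $y = sx + (1-s)w$ expresses [x] as a convex
    combination of [w] and [z], both in the hull of [A], unless [t = 1], where [x = y]. *)
Lemma convex_hull_anti_exchange (k : nat) (A : set 'rV[R]_k) x y :
  ~ convex_hull A x -> convex_hull (y |` A) x -> convex_hull (x |` A) y -> x = y.
Proof.
have [->|/set0P A0] := eqVneq A set0.
  rewrite !setU0 => _ xy _.
  apply: (convex_hull_sub (B := [set y])) xy => //.
  by apply/convex_setP => _ _ t _ -> ->; rewrite -scalerDl addrC subrK scale1r.
move=> xA /(convex_hull_setU1 A0) [t [z [/andP[t0 t1] zA xE]]].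
move=> /(convex_hull_setU1 A0) [s [w [/andP[s0 s1] wA yE]]].
have [t1'|t1'] := eqVneq t 1; first by rewrite xE t1' subrr scale0r addr0 scale1r.
exfalso; apply: xA.
have ts : 0 < 1 - t * s.
  by rewrite subr_gt0; apply: le_lt_trans (_ : t < 1);
    [rewrite ler_piMr | rewrite lt_neqAle t1'].
pose u := t * (1 - s) / (1 - t * s).
have -> : x = u *: w + (1 - u) *: z.
  apply: (scalerI (a := 1 - t * s)); first by rewrite gt_eqF.
  have uE : (1 - t * s) * u = t * (1 - s) by rewrite mulrC divfK ?gt_eqF.
  rewrite scalerDr !scalerA [_ * (1 - u)]mulrBr mulr1 uE.
  apply/rowP => i; have := congr1 (fun v : 'rV_k => v 0 i) xE.
  by have := congr1 (fun v : 'rV_k => v 0 i) yE; rewrite !mxE => ->; lra.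
have /convex_setP := @convex_hull_convex _ _ A; apply => //.
apply/andP; split; last by rewrite ler_pdivrMr // mul1r; nra.
by apply: divr_ge0 (ltW ts); rewrite mulr_ge0 ?subr_ge0.
Qed.

(** The lattice points of a box form a finite closure system under hulls. Coloured by parity they
    have $2^d$ colours, and two points of one colour have a lattice midpoint. *)
Lemma helly_int_points (d : nat) : helly_le (@int_points R d) (2 ^ d)%N.
Proof.
apply: helly_le_critical => I C x J cC Jd xZ Cx.
(* The box $[-N, N]^d$ contains every [x i] with [i] in [J]; [S] stores its points shifted by
   [N]. *)
pose N := (\max_(i in J) \max_j `|Num.floor (x i ord0 j)|)%N.
pose S := {ffun 'I_d -> 'I_(N + N).+1}.
pose emb (s : S) : 'rV[R]_d := \row_j ((s j)%:R - N%:R).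
have emb_inj : injective emb.
  move=> s t /rowP st; apply/ffunP => j; apply: val_inj => /=.
  by have := st j; rewrite !mxE => /addIr /eqP; rewrite eqr_nat => /eqP.
have emb_int s : int_points (emb s).
  by move=> j; rewrite mxE rpredB ?rpred_nat.
have emb_surj i : i \in J -> exists s, emb s = x i.
  move=> iJ.
  have bnd j : (`|Num.floor (x i ord0 j)| <= N)%N.
    apply: leq_trans (leq_bigmax_cond _ iJ); exact: (leq_bigmax j).
  exists [ffun j => inord `|(Num.floor (x i ord0 j) + N%:Z)%R|%N].
  apply/rowP => j; rewrite !mxE ffunE.
  have xj : x i ord0 j = (Num.floor (x i ord0 j))%:~R by rewrite floorK //; apply: xZ.
  have [f0 f1] : 0 <= Num.floor (x i ord0 j) + N%:Z /\
    (`|(Num.floor (x i ord0 j) + N%:Z)%R| < (N + N).+1)%N by have := bnd j; lia.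
  rewrite inordK // natr_absz ger0_norm // [RHS]xj intrD.
  by rewrite addrK.
pose hull (A : {set S}) := convex_hull [set emb s | s in [set` A]].
pose cl (A : {set S}) : {set S} := [set s | `[< hull A (emb s) >]]%SET.
have inC i s : s \in [set s | `[< C i (emb s) >]]%SET = `[< C i (emb s) >].
  by rewrite inE.
have incl A s : s \in cl A = `[< hull A (emb s) >] by rewrite inE.
have sub_cl (A : {set S}) : A \subset cl A.
  apply/fintype.subsetP => s sA; rewrite incl; apply/asboolP.
  by apply: subset_convex_hull; exists s.
have hull_mono (A : {set S}) (B : set 'rV[R]_d) : @convex_set R 'rV[R]_d B ->
    (forall s, s \in A -> B (emb s)) -> hull A `<=` B.
  by move=> cB AB; apply: convex_hull_sub => // _ [s sA <-]; exact: AB.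
have hullcl (A : {set S}) : hull (cl A) `<=` hull A.
  apply: hull_mono; first exact: convex_hull_convex.
  by move=> s; rewrite incl => /asboolP.
have hullU (A : {set S}) s : hull (s |: A) = convex_hull (emb s |` [set emb s | s in [set` A]]).
  congr convex_hull; apply/seteqP; split=> [_ [t /= /setU1P[->|tA] <-]|v [->|[t /= tA <-]]].
  - by left.
  - by right; exists t.
  - by exists s => //=; rewrite setU11.
  - by exists t => //=; rewrite setU1r.
have [||||||||y yC] := @closure_helly S {ffun 'I_d -> bool} I cl
    (fun s => [ffun j => odd (s j)]) J _ _ _ _ _ (fun i => [set s | `[< C i (emb s) >]]%SET).
- exact: sub_cl.
- move=> A B /fintype.subsetP AB; apply/fintype.subsetP => s; rewrite !incl.
  move=> /asboolP sA; apply/asboolP; move: sA; apply: convex_hull_mono.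
  by move=> _ [t tA <-]; exists t => //; exact: AB.
- move=> A; apply/eqP; rewrite finset.eqEsubset sub_cl andbT.
  apply/fintype.subsetP => s; rewrite !incl => /asboolP /hullcl ?; exact/asboolP.
- move=> A s t; rewrite !incl !hullU => /asboolP sA /asboolP st /asboolP ts.
  by apply: emb_inj; exact: (convex_hull_anti_exchange (A := [set emb s | s in [set` A]])).
- move=> s t st /ffunP col.
  have col' j : odd (s j) = odd (t j) by have := col j; rewrite !ffunE.
  pose p : S := [ffun j => inord (s j + t j)./2].
  have pE j : (p j).*2 = (s j + t j)%N.
    rewrite ffunE inordK; last by have := ltn_ord (s j); have := ltn_ord (t j); lia.
    by rewrite halfK oddD col' addbb subn0.
  exists p; split.
  + apply: contra st => /eqP ps; apply/eqP/ffunP => j; apply: val_inj => /=.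
    by have := pE j; rewrite ps -addnn => /addnI.
  + apply: contra st => /eqP ps; apply/eqP/ffunP => j; apply: val_inj => /=.
    by have := pE j; rewrite ps -addnn => /addIn.
  + rewrite incl; apply/asboolP.
    have -> : emb p = 2^-1 *: emb s + (1 - 2^-1) *: emb t.
      apply/rowP => j; rewrite !mxE.
      have : ((p j).*2)%:R = (s j + t j)%:R :> R by rewrite pE.
      by rewrite -muln2 natrM natrD; lra.
    have /convex_setP := @convex_hull_convex _ _ [set emb s | s in [set` [set s; t]%SET]].
    apply; first by lra.
    * by apply: subset_convex_hull; exists s; rewrite //= !inE eqxx.
    * by apply: subset_convex_hull; exists t; rewrite //= !inE eqxx orbT.
- move=> i iJ; apply/eqP; rewrite finset.eqEsubset sub_cl andbT.
  apply/fintype.subsetP => s; rewrite incl inC => /asboolP h; apply/asboolP; move: h.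
  by apply: hull_mono => // t; rewrite inC => /asboolP.
- by rewrite card_ffun card_bool card_ord.
- move=> i iJ; have [s sE] := emb_surj i iJ; exists s => j jJ ji.
  by rewrite inC sE; apply/asboolP; apply: Cx => //; rewrite eq_sym.
by exists (emb y) => // i /yC; rewrite inC => /asboolP.
Qed.
End Doignon.

(** * Helly numbers of products *)

Section HellyProduct.
Context {R : realType}.

(* Sets of at most [h] members of the family are projected along M: a point of N in
   all these projections has a fibre to which the Helly number of M applies. *)
Lemma helly_prod (k d h h' : nat) (M : set 'rV[R]_k) (N : set 'rV[R]_d) :
  @convex_set R 'rV[R]_k M -> helly_le M h -> helly_le N h' ->
  helly_le (prod_rV M N) (h * h').
Proof.
move=> /convex_setP cM hM hN I C cC hC.
(* Sets [K] of more than [h] members impose nothing, so the projected family can be indexed by all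
   subsets of [I]. *)
pose D (K : {set I}) : set 'rV[R]_d := [set z | (#|K| <= h)%N ->
  exists2 u, M u & forall i, i \in K -> C i (row_mx u z)].
have comb (t : R) (u u' : 'rV[R]_k) (z z' : 'rV[R]_d) :
    row_mx (t *: u + (1 - t) *: u') (t *: z + (1 - t) *: z')
    = t *: row_mx u z + (1 - t) *: row_mx u' z'.
  by rewrite !scale_row_mx add_row_mx.
have [|KK KKh|z Nz Dz] := hN {set I} D.
- move=> K; apply/convex_setP => z z' t t01 Dz Dz' Kh.
  have [u Mu Cu] := Dz Kh; have [u' Mu' Cu'] := Dz' Kh.
  exists (t *: u + (1 - t) *: u'); first exact: cM.
  move=> i iK; rewrite comb; move/convex_setP: (cC i); apply => //.
    exact: Cu.
  exact: Cu'.
(* At most [h'] sets of at most [h] indices each cover at most [h * h'] indices. *)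
- have [|y [My Ny] Cy] := hC (finset.cover [set K in KK | (#|K| <= h)%N]%SET).
    apply: leq_trans (leq_card_cover _) _.
    apply: (@leq_trans (\sum_(K in [set K in KK | (#|K| <= h)%N]%SET) h)%N).
      by apply: leq_sum => K; rewrite inE => /andP[].
    rewrite sum_nat_const mulnC leq_mul2l; apply/orP; right.
    apply: leq_trans KKh; apply: subset_leq_card; apply/fintype.subsetP => K.
    by rewrite inE => /andP[].
  exists (rsubmx y) => // K KKK Kh; exists (lsubmx y) => // i iK.
  rewrite hsubmxK; apply: Cy; apply/finset.bigcupP; exists K => //.
  by rewrite inE KKK.
- have [|J Jh|u Mu Cu] := hM I (fun i => [set u | C i (row_mx u z)]).
  + move=> i; apply/convex_setP => u u' t t01 Cu Cu'.
    have /convex_setP := cC i; move=> /(_ (row_mx u z) (row_mx u' z) t t01 Cu Cu').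
    by rewrite -comb -scalerDl [t + _]addrC subrK scale1r.
  + by have [u Mu Cu] := Dz J Jh; exists u.
  + by exists (row_mx u z) => //; split; rewrite ?row_mxKl ?row_mxKr.
Qed.

Lemma helly_mixed_integer (n d : nat) :
  helly_le (prod_rV (@setT 'rV[R]_n) (@int_points R d)) (n.+1 * 2 ^ d)%N.
Proof.
apply: helly_prod; [exact/convex_setP|exact: helly_real_space|exact: helly_int_points].
Qed.
End HellyProduct.

(** * From Helly numbers to Radon numbers *)

Section RadonUpper.
Context {R : realType}.

Lemma card_le_injection (k r : nat) (A : set 'rV[R]_k) : (`I_r #<= A)%card ->
  exists x : 'I_r -> 'rV[R]_k, injective x /\ forall i, A (x i).
Proof.
move=> /pcard_leP /unsquash f; exists (fun i => f i); split=> [i j /= fij|i].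
  by apply: val_inj; apply: (inj (f := f)) fij; rewrite inE /=.
by apply: (funS (s := f)) => /=.
Qed.

(* Eckhoff-Jamison: with one point p singled out, a common point q of
   the hulls of A minus F, for F = {p} and for the F with p \notin F and #|F| <= k, is
   a Radon point.  In R^k, Caratheodory's theorem gives G with q in conv G, and if
   #|G| = k + 1 then q lies on segments from each g in G to conv (A minus G); averaging
   their endpoints as q is averaged from G puts q itself in conv (A minus G). *)
Lemma radon_property_helly (k h : nat) (M : set 'rV[R]_k) : (0 < k)%N ->
  helly_le M h.+1 -> radon_property M (k * h).+2.
Proof.
move=> k0 hM A AM /card_le_injection [x [x_inj xA]].
pose p : 'I_(k * h).+2 := ord0.
pose H (F : {set 'I_(k * h).+2}) := convex_hull [set x i | i in [set` F]].
have HC F : @convex_set R 'rV[R]_k (H F) by exact: convex_hull_convex.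
have xH (F : {set 'I_(k * h).+2}) i : i \in F -> H F (x i).
  by move=> iF; apply: subset_convex_hull; exists i.
suff [G [q [Mq Gq GCq]]] : exists G q, [/\ M q, H G q & H (~: G) q].
  exists [set x i | i in [set` G]], [set x i | i in [set` ~: G]]; split.
  - by move=> _ [i _ <-].
  - by move=> _ [i _ <-].
  - apply/seteqP; split=> // _ [[i /= iG <-] [j /= jG /x_inj ji]].
    by move: jG; rewrite ji inE iG.
  - by exists q.
pose small (F : {set 'I_(k * h).+2}) := (p \notin F) && (#|F| <= k)%N.
have [|J Jh|q Mq Hq] := hM _
    (fun F : {set _} => [set y | (F == [set p]%SET) || small F -> H (~: F) y]).
- move=> F; apply/convex_setP => u v t t01 Hu Hv Fp.
  by move/convex_setP: (HC (~: F)); apply; [|exact: Hu|exact: Hv].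
(* Without [[set p]] in [J], the point [x p] serves, since small sets avoid [p]. Otherwise [[set p]]
   takes one of the [h + 1] places; the small sets and [p] cover at most [k * h + 1] of the
   [k * h + 2] indices, and an index is left over. *)
- have [pJ|pJ] := boolP ([set p]%SET \in J); last first.
    exists (x p) => [|F FJ /= /orP[/eqP Fp|/andP[pF _]]]; first exact: AM.
      by rewrite Fp (negbTE pJ) in FJ.
    by apply: xH; rewrite inE.
  pose U := finset.cover [set F in J | small F]%SET.
  have Uk : (#|U| <= k * h)%N.
    apply: leq_trans (leq_card_cover _) _.
    apply: (@leq_trans (\sum_(F in [set F in J | small F]%SET) k)%N).
      by apply: leq_sum => F; rewrite inE => /andP[_ /andP[]].
    rewrite sum_nat_const mulnC leq_mul2l; apply/orP; right.
    rewrite -ltnS; apply: leq_trans Jh; apply: proper_card; apply/properP; split.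
      by apply/fintype.subsetP => F; rewrite inE => /andP[].
    by exists [set p]%SET => //; rewrite !inE /small !inE eqxx andbF.
  have /card_gt0P [i] : (0 < #|~: (p |: U)|)%N.
    rewrite cardsCs finset.setCK card_ord subn_gt0 ltnS cardsU1.
    by case: (p \in U) => /=; rewrite ?add0n ?add1n ?ltnS // ltnW.
  rewrite !inE negb_or => /andP[ip iU].
  exists (x i) => [|F FJ /= Fp]; first exact: AM.
  apply: xH; rewrite inE; case/orP: Fp => [/eqP ->|Fs]; first by rewrite inE.
  apply: contra iU => iF; apply/finset.bigcupP; exists F => //.
  by rewrite inE FJ.
have radon_small F : small F -> H F q -> exists G q, [/\ M q, H G q & H (~: G) q].
  by move=> Fs Fq; exists F, q; split=> //; apply: Hq; rewrite Fs orbT.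
have [|G [Gp Gk Gq]] := caratheodory (x := x) (F := (~: [set p])%SET) (y := q).
  by apply: Hq; rewrite eqxx.
have pG : p \notin G.
  by apply/negP => /(fintype.subsetP Gp); rewrite !inE eqxx.
have [Gk'|Gk'] := leqP #|G| k; first by apply: (radon_small G); rewrite // /small pG.
(* [G :\ g] is small, so [q] lies in the hull of [x g] and the points outside [G]. *)
have ex g : exists tz : R * 'rV[R]_k, g \in G ->
    [/\ 0 <= tz.1 <= 1, H (~: G) tz.2 & q = tz.1 *: x g + (1 - tz.1) *: tz.2].
  have [gG|] := boolP (g \in G); last by exists 0.
  suff [t [z tz]] : exists (t : R) z,
    [/\ 0 <= t <= 1, H (~: G) z & q = t *: x g + (1 - t) *: z] by exists (t, z).
  apply: convex_hull_setU1; first by exists (x p), p => //=; rewrite inE.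
  have : H (~: (G :\ g)) q.
    apply: Hq; apply/orP; right; apply/andP; split; first by rewrite !inE negb_and pG orbT.
    by move: Gk; rewrite (cardsD1 g) gG.
  apply: convex_hull_mono => _ [i /= + <-]; rewrite !inE negb_and negbK.
  move=> /orP[/eqP ->|iG]; [by left|right].
  by exists i => //=; rewrite inE.
have [tz tzP] := choice ex.
have [[g gG tg]|t1] := pselect (exists2 g, g \in G & (tz g).1 = 1).
  have [_ _ qE] := tzP g gG.
  apply: (radon_small [set g]%SET).
    by rewrite /small cards1 k0 andbT inE; apply: contra pG => /eqP ->.
  by rewrite qE tg subrr scale0r addr0 scale1r; apply: xH; rewrite inE.
have [[g gG tg]|t0] := pselect (exists2 g, g \in G & (tz g).1 = 0).
  exists G, q; split=> //.
  by have [_ ? ->] := tzP g gG; rewrite tg scale0r add0r subr0 scale1r.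
have t01 g : g \in G -> 0 < (tz g).1 < 1.
  move=> gG; have [/andP[t0' t1'] _ _] := tzP g gG.
  rewrite !lt_neqAle t0' t1' !andbT; apply/andP; split.
    by apply/eqP => t; apply: t0; exists g.
  by apply/eqP => t; apply: t1; exists g.
have [w [w0 wG w1 qE]] := (convex_hull_image_fin x G q).1 Gq.
(* From $q = t_g x_g + (1-t_g) z_g$ follows $q - x_g = \frac{1-t_g}{t_g}(z_g - q)$. Weighted by [w],
   the left sides sum to 0, so [q] is the mean of the $z_g$ with weights [a g]. *)
pose a g := w g * ((1 - (tz g).1) / (tz g).1).
have a0 g : 0 <= a g.
  have [gG|gG] := boolP (g \in G); last by rewrite /a wG // mul0r.
  have /andP[? ?] := t01 g gG.
  by rewrite mulr_ge0 // divr_ge0 ?subr_ge0 ?ltW.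
have wa g : 0 < a g -> g \in G.
  by apply: contraLR => gG; rewrite /a wG // mul0r ltxx.
have s0 : 0 < \sum_g a g.
  rewrite lt_neqAle sumr_ge0 // andbT eq_sym; apply/eqP => a_eq0.
  have /eqP : \sum_g w g = 0.
    apply: big1 => g _; have [gG|/wG //] := boolP (g \in G).
    move/eqP: a_eq0; rewrite psumr_eq0 // => /allP /(_ g (mem_index_enum _)) /=.
    have /andP[? ?] := t01 g gG.
    by rewrite mulf_eq0 => /orP[/eqP //|]; rewrite gt_eqF // divr_gt0 ?subr_gt0.
  by rewrite w1 oner_eq0.
have qz : \sum_g a g *: (tz g).2 = (\sum_g a g) *: q.
  apply/eqP; rewrite -subr_eq0 scaler_suml -sumrB.
  rewrite (eq_bigr (fun g => w g *: q - w g *: x g)) => [|g _].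
    by rewrite sumrB -scaler_suml w1 scale1r -qE subrr.
  have [gG|gG] := boolP (g \in G); last by rewrite /a wG // mul0r !scale0r.
  have [_ _ qEg] := tzP g gG; have /andP[tg0 _] := t01 g gG.
  apply/rowP => j; have := congr1 (fun v : 'rV_k => v 0 j) qEg.
  rewrite !mxE /a => ->; field; exact: lt0r_neq0.
exists G, q; split=> //.
have -> : q = \sum_g (a g / \sum_g a g) *: (tz g).2.
  apply: (scalerI (a := \sum_g a g)); first by rewrite gt_eqF.
  rewrite -qz scaler_sumr; apply: eq_bigr => g _.
  by rewrite scalerA mulrC divfK // gt_eqF.
apply: convex_set_sum => //.
- by move=> g; rewrite divr_ge0 // ltW.
- by rewrite -mulr_suml divff // gt_eqF.
- by move=> g; rewrite pmulr_lgt0 ?invr_gt0 // => /wa /tzP [].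
Qed.
End RadonUpper.

(** * Lower bounds on Radon numbers and the mixed-integer case *)

Section RadonLower.
Context {R : realType}.

Lemma injection_card_le (k r : nat) (A : set 'rV[R]_k) (I : finType) (x : I -> 'rV[R]_k) :
  (r <= #|I|)%N -> injective x -> (forall i, A (x i)) -> (`I_r #<= A)%card.
Proof.
case: r => [|r] rI x_inj xA; first by rewrite II0 card_ge0.
have I0 : (0 < #|I|)%N by apply: leq_trans rI.
have i0 : I by move: I0 => /card_gt0P /cid[].
pose f j := x (nth i0 (enum I) j).
have f_inj : {in `I_r.+1 &, injective f}.
  move=> i j; rewrite !inE /= => ir jr /x_inj /eqP.
  by rewrite nth_uniq ?enum_uniq -?cardE ?(leq_trans _ rI) // => /eqP.
rewrite -(card_le_eql (inj_card_eq f_inj)); apply: subset_card_le => _ [j _ <-].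
exact: xA.
Qed.

Lemma radon_property_ge (k r s : nat) (M : set 'rV[R]_k) :
  (r <= s)%N -> radon_property M r -> radon_property M s.
Proof.
move=> rs Mr A AM As; apply: Mr => //; apply: card_le_trans As.
by apply: subset_card_le => i /= /leq_trans; apply.
Qed.

Definition unit_cube (d : nat) : set 'rV[R]_d := [set z | forall j, 0 <= z 0 j <= 1].
Definition cube_vertices (d : nat) : set 'rV[R]_d :=
  [set z | forall j, z 0 j = 0 \/ z 0 j = 1].

Lemma unit_cube_extreme (d : nat) (z y1 y2 : 'rV[R]_d) (t : R) :
  cube_vertices z -> unit_cube y1 -> unit_cube y2 -> 0 < t < 1 ->
  t *: y1 + (1 - t) *: y2 = z -> y1 = z /\ y2 = z.
Proof.
move=> zv c1 c2 /andP[t0 t1] /rowP E.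
have H j : y1 0 j = z 0 j /\ y2 0 j = z 0 j.
  have := E j; rewrite !mxE; have /andP[? ?] := c1 j; have /andP[? ?] := c2 j.
  by case: (zv j) => -> ?; split; nra.
by split; apply/rowP => j; have [] := H j.
Qed.

(** A vertex is an extreme point of the cube, so a proper convex combination lies above it only if
    both of its points do. *)
Lemma convex_hull_fibre (k d : nat) (B : set 'rV[R]_(k + d)) y :
  B `<=` [set y | cube_vertices (rsubmx y)] ->
  convex_hull B y -> unit_cube (rsubmx y) /\ (cube_vertices (rsubmx y) ->
    convex_hull [set u | B (row_mx u (rsubmx y))] (lsubmx y)).
Proof.
move=> Bv By.
(* With the vertex [z] fixed beforehand, the condition defines a convex set of points [y]. *)
suff H z : cube_vertices z -> convex_hull B `<=` [set y | unit_cube (rsubmx y) /\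
    (rsubmx y = z -> convex_hull [set u | B (row_mx u z)] (lsubmx y))].
  split=> [|yv]; last exact: (H _ yv y By).2.
  by apply: (H (const_mx 0) _ y By).1 => j; left; rewrite mxE.
move=> zv; apply: convex_hull_sub; last first.
  move=> {By}y By /=; split=> [j|yz].
    by case: (Bv _ By j) => ->; rewrite lexx ler01.
  by apply: subset_convex_hull; rewrite /= -yz hsubmxK.
apply/convex_setP => y1 y2 t /andP[t0 t1] [c1 h1] [c2 h2] /=.
rewrite !linearD !linearZ /=; split=> [j|yz].
  have := c1 j; have := c2 j; rewrite !mxE => /andP[? ?] /andP[? ?].
  by apply/andP; split; nra.
have [tz|tz] := eqVneq t 0.
  by move: yz; rewrite tz !scale0r subr0 !scale1r !add0r; exact: h2.
have [t1'|t1'] := eqVneq t 1.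
  by move: yz; rewrite t1' subrr !scale0r !scale1r !addr0; exact: h1.
have [|y1z y2z] := unit_cube_extreme (t := t) zv c1 c2 _ yz.
  by rewrite !lt_neqAle t0 t1 eq_sym tz t1'.
have /convex_setP := @convex_hull_convex _ _ [set u | B (row_mx u z)].
by apply; [rewrite t0 t1|exact: h1|exact: h2].
Qed.

Lemma not_radon_property_prod_int (k d r : nat) (M : set 'rV[R]_k) :
  ~ radon_property M r -> ~ radon_property (prod_rV M (@int_points R d)) (r * 2 ^ d).
Proof.
move=> nM Md; apply: nM => A AM Ar.
have [x [x_inj xA]] := card_le_injection Ar.
pose A' : set 'rV[R]_(k + d) := prod_rV A (@cube_vertices d).
pose v (f : {ffun 'I_d -> bool}) : 'rV[R]_d := \row_j (f j)%:R.
have v_inj : injective v.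
  move=> f g /rowP fg; apply/ffunP => j; have := fg j; rewrite !mxE => /eqP.
  by rewrite eqr_nat; case: (f j) (g j) => [] [].
have [||B [C [BA CA BC [y [[[My Zy] By] Cy]]]]] := Md A'.
- move=> y [Ay Vy]; split; first exact: AM.
  by move=> j; case: (Vy j) => ->; rewrite ?rpred0 ?rpred1.
- apply: (injection_card_le (I := ('I_r * {ffun 'I_d -> bool})%type)
    (x := fun p => row_mx (x p.1) (v p.2))).
  + by rewrite card_prod card_ffun card_bool !card_ord.
  + by move=> [i f] [j g] /= /eq_row_mx[/x_inj -> /v_inj ->].
  + move=> [i f] /=; split; rewrite ?row_mxKl ?row_mxKr; first exact: xA.
    by move=> j; rewrite mxE; case: (f j); [right|left].
have [yc By'] : unit_cube (rsubmx y) /\ (cube_vertices (rsubmx y) ->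
    convex_hull [set u | B (row_mx u (rsubmx y))] (lsubmx y)).
  by apply: convex_hull_fibre => // u /BA[].
have [_ Cy'] : unit_cube (rsubmx y) /\ (cube_vertices (rsubmx y) ->
    convex_hull [set u | C (row_mx u (rsubmx y))] (lsubmx y)).
  by apply: convex_hull_fibre => // u /CA[].
have yv : cube_vertices (rsubmx y).
  move=> j; have /andP[] := yc j; have /intrP[z ->] := Zy j.
  rewrite ler0z lerz1 => z0 z1.
  have [->|->] : z = 0 \/ z = 1 by lia.
    by left.
  by right.
(* The fibres of [B] and [C] above the vertex [rsubmx y] form a Radon partition in [A]. *)
exists [set u | B (row_mx u (rsubmx y))], [set u | C (row_mx u (rsubmx y))].
split.
- by move=> u /BA[]; rewrite row_mxKl.
- by move=> u /CA[]; rewrite row_mxKl.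
- apply/seteqP; split=> // u [Bu Cu].
  by have : (B `&` C) (row_mx u (rsubmx y)) by []; rewrite BC.
- by exists (lsubmx y); split; [split|]; [|exact: By'|exact: Cy'].
Qed.

(** Let [y] be common to the hulls of disjoint [B] and [C]. For each [j] one of them misses $e_j$,
    so every coordinate of [y] is 0; one of them misses the origin, so the coordinates sum to 1. *)
Lemma not_radon_property_real_space (n : nat) :
  ~ radon_property (@setT 'rV[R]_n) n.+1.
Proof.
pose x (i : option 'I_n) : 'rV[R]_n := if i is Some j then delta_mx 0 j else 0.
have xE i j : x i 0 j = (i == Some j)%:R.
  by case: i => [i|] /=; rewrite !mxE ?eqxx //= eq_sym.
have x_inj : injective x.
  move=> [i|] [j|] // /rowP ij.
  - by have /eqP := ij j; rewrite !xE eqxx eqr_nat; case: (Some i =P Some j).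
  - by have /eqP := ij i; rewrite !xE eqxx /= oner_eq0.
  - by have /eqP := ij j; rewrite !xE eqxx eq_sym /= oner_eq0.
move=> /(_ (range x)) [//||B [C [BA CA BC [y [[_ By] Cy]]]]].
  apply: (injection_card_le (x := x)) => //; first by rewrite card_option card_ord.
have coord0 (D : set 'rV[R]_n) j : D `<=` range x -> ~ D (x (Some j)) ->
    convex_hull D y -> y 0 j = 0.
  move=> Dx Dj; apply: (convex_hull_sub (B := [set y | y 0 j = 0])).
    by apply/convex_setP => u v t _ /= u0 v0; rewrite !mxE u0 v0 !mulr0 addr0.
  move=> u Du; have [i _ ui] := Dx _ Du; rewrite /= -ui xE.
  by case: eqP => // ij; exfalso; apply: Dj; rewrite -ij ui.
have y0 j : y 0 j = 0.
  have [Bj|Bj] := pselect (B (x (Some j))); last exact: (coord0 B).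
  apply: (coord0 C) => // Cj.
  by have : (B `&` C) (x (Some j)) by []; rewrite BC.
have sum1 (D : set 'rV[R]_n) : D `<=` range x -> ~ D (x None) ->
    convex_hull D y -> False.
  move=> Dx D0 Dy.
  have : \sum_j y 0 j = 1.
    move: Dy; apply: (convex_hull_sub (B := [set y | \sum_j y 0 j = 1])).
      apply/convex_setP => u v t _ /= u1 v1.
      under eq_bigr => j _ do rewrite !mxE.
      by rewrite big_split /= -!mulr_sumr u1 v1; ring.
    move=> u Du; have [[i|] _ ui] := Dx _ Du; last by rewrite -ui in Du.
    rewrite /= -ui; under eq_bigr => j _ do rewrite xE.
    rewrite (bigD1 i) //= eqxx big1 ?addr0 // => j ji.
    by rewrite (_ : _ == _ = false) //; apply: contra_neqF ji => /eqP[->].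
  rewrite big1 => [/eqP|j _]; last exact: y0.
  by rewrite eq_sym oner_eq0.
have [B0|B0] := pselect (B (x None)); last exact: (sum1 B).
apply: (sum1 C) => // C0.
by have : (B `&` C) (x None) by []; rewrite BC.
Qed.

Lemma radon_number_le (k r : nat) (M : set 'rV[R]_k) :
  radon_property M r -> (radon_number M <= r%:R%:E)%E.
Proof.
move=> Mr; rewrite /radon_number; case: pselect => [ex|]; last first.
  by case; exists r; apply/asboolP.
by case: ex_minnP => m _ mmin; rewrite lee_fin ler_nat; apply/mmin/asboolP.
Qed.

Lemma radon_number_ge (k r : nat) (M : set 'rV[R]_k) :
  ~ radon_property M r -> (r.+1%:R%:E <= radon_number M)%E.
Proof.
move=> Mr; rewrite /radon_number; case: pselect => [ex|_]; last exact: leey.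
case: ex_minnP => m /asboolP Mm _; rewrite lee_fin ler_nat ltnNge.
by apply/negP => /radon_property_ge /(_ Mm).
Qed.

Lemma radon_number_prod_int (k d : nat) (M : set 'rV[R]_k) :
  ((radon_number M - 1) * (2 ^+ d)%:E + 1
     <= radon_number (prod_rV M (@int_points R d)))%E.
Proof.
have lower r : ~ radon_property M r ->
    ((r * 2 ^ d).+1%:R%:E <= radon_number (prod_rV M (@int_points R d)))%E.
  by move=> Mr; apply: radon_number_ge; exact: not_radon_property_prod_int.
rewrite [X in ((X - _) * _)%E]/radon_number; case: pselect => [ex|nex].
  (* A minimum of 0 has no predecessor at which the property fails; there the left side is $1 - 2^d
     \le 0$. *)
  case: ex_minnP => -[|m] _ mmin.
    apply: (@le_trans _ _ 0%E).
      rewrite -EFinB -EFinM -EFinD lee_fin.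
      have : 1 <= 2 ^+ d :> R by rewrite exprn_ege1 // ler1n.
      by lra.
    by rewrite /radon_number; case: pselect => *; rewrite ?lee_fin ?leey.
  have {mmin} Mm : ~ radon_property M m.
    by move=> /asboolP /mmin; rewrite ltnn.
  apply: le_trans (lower m Mm).
  rewrite -EFinB -EFinM -EFinD lee_fin.
  by rewrite -[m.+1]addn1 -[(_ * _).+1]addn1 !natrD natrM natrX addrK.
suff -> : radon_number (prod_rV M (@int_points R d)) = +oo%E by rewrite leey.
rewrite /radon_number; case: pselect => // ex; exfalso.
(* The property of the product at [r] persists at [r * 2 ^ d], which would give it to [M] at [r]. *)
have [r /asboolP Mr] := ex; have := @not_radon_property_prod_int k d r M; case.
  by move=> Mr'; apply: nex; exists r; apply/asboolP.
by apply: radon_property_ge Mr; rewrite leq_pmulr // expn_gt0.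
Qed.

Lemma radon_property_mixed_integer (n d : nat) :
  radon_property (prod_rV (@setT 'rV[R]_n) (@int_points R d))
    ((n + d) * (n.+1 * 2 ^ d).-1).+2.
Proof.
(* In dimension 0 the space is a single point, so no set has the two elements that the bound 2
   demands. *)
have [nd0|nd] := posnP (n + d)%N; last first.
  apply: radon_property_helly => //.
  by rewrite prednK ?muln_gt0 ?expn_gt0 //; exact: helly_mixed_integer.
move=> A _ /card_le_injection [x [x_inj _]].
have /x_inj /(congr1 val) // : x ord0 = x ord_max.
apply/rowP => j; have : (0 < n + d)%N by apply: leq_ltn_trans (ltn_ord j).
by rewrite lt0n => /eqP.
Qed.
End RadonLower.

Theorem theorem1p5 (R : realType) (k n d : nat) (M : set 'rV[R]_k)
    (M_nonempty : M !=set0) (M_closed : closed M) :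
  ((radon_number M - 1) * (2 ^+ d)%:E + 1
     <= radon_number (prod_rV M (@int_points R d)))%E /\
  (((n%:R + 1) * 2 ^+ d + 1)%:E
     <= radon_number (prod_rV (@setT 'rV[R]_n) (@int_points R d))
     <= ((n%:R + d%:R) * (n%:R + 1) * 2 ^+ d - n%:R - d%:R + 2)%:E)%E.
Proof.
split; first exact: radon_number_prod_int.
apply/andP; split.
  have := radon_number_ge (@not_radon_property_prod_int _ _ d _ _
    (@not_radon_property_real_space R n)).
  by rewrite -[(_ * _).+1]addn1 -[n.+1]addn1 natrD natrM natrX natrD.
apply: le_trans (radon_number_le (@radon_property_mixed_integer R n d)) _.
rewrite lee_fin -[_.+2]addn2 natrD natrM -subn1 natrB ?muln_gt0 ?expn_gt0 //.
by rewrite natrM natrX natrD -[n.+1]addn1 natrD; lra.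
Qed.
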